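(* Let $\rho$ be a calibration function and set $u_k=\lfloor\rho^{-1}(k)\rfloor$ for $k\in\mathbb{N}$. Let $1\le p<\infty$, let $\mathbf{w}=(w_n)_{n=1}^\infty$ be a bounded sequence of positive real numbers, let $B_{\mathbf{w}}$ be the corresponding weighted backward shift on $\ell^p(\mathbb{N})$, and put $\alpha_n=\frac{1}{w_1w_2\cdots w_n}$ for $n\ge1$. If, for each $i\in\mathbb{N}$, the series $$\sum_{j=1}^\infty \alpha_{i+u_{j+k}-u_k}^{\,p}$$ is convergent, uniformly in $k\in\mathbb{N}$ (that is, for each $i\in\mathbb{N}$ and each $\epsilon>0$ there is a natural number $N$ such that $\sum_{j=N}^\infty\alpha_{i+u_{j+k}-u_k}^{\,p}\le\epsilon$ for every $k\in\mathbb{N}$), then $B_{\mathbf{w}}$ is $\rho$-frequently hypercyclic on $\ell^p(\mathbb{N})$.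
   Context: $\mathbb{N}=\{1,2,3,\dots\}$. A calibration function is a function $\rho\colon[0,\infty)\to[0,\infty)$ such that: (1) $\rho$ is continuous, strictly increasing and unbounded; (2) $|\rho(t_1)-\rho(t_2)|\le|t_1-t_2|$ for all $t_1,t_2\ge0$; (3) $\rho$ is concave; (4) $\rho(t)/t$ is a non-increasing function of $t>0$; normalized so that $\rho(0)=0$. (Only the behaviour of $\rho$ for large $t$ matters, and functions having these properties only for large $t$ are regarded as calibration functions after modification for small $t$.) The lower $\rho$-density of $\mathcal{A}\subseteq\mathbb{N}$ is $\liminf_{N\to\infty}\frac{\#\{n\in\mathcal{A}: n\le N\}}{\rho(N)}\in[0,\infty]$. A continuous linear operator $T$ on a separable infinite-dimensional Fréchet space $X$ is $\rho$-frequently hypercyclic if there is $x\in X$ such that, for each nonempty open $U\subset X$, the return set $\{n\in\mathbb{N}: T^nx\in U\}$ has positive lower $\rho$-density. Elements of $\ell^p(\mathbb{N})$ are written $(x_0,x_1,x_2,\dots)$, with canonical basis $(e_n)_{n=0}^\infty$. The weighted backward shift is $B_{\mathbf{w}}(x_0,x_1,x_2,\dots)=(w_1x_1,w_2x_2,w_3x_3,\dots)$, i.e. $B_{\mathbf{w}}e_0=0$ and $B_{\mathbf{w}}e_n=w_ne_{n-1}$ for $n\ge1$. *)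

(* Defs.v *)
From HB Require Import structures.
From mathcomp Require Import all_boot all_order all_algebra.
From mathcomp Require Import complex.
From mathcomp Require Import all_classical all_reals all_analysis.

Set Implicit Arguments.
Unset Strict Implicit.
Unset Printing Implicit Defensive.

Import Order.TTheory GRing.Theory Num.Theory.
Import numFieldNormedType.Exports.
Local Open Scope classical_set_scope.
Local Open Scope ring_scope.

(* A map [0, +oo[ -> [0, +oo[ is represented by a map R -> R whose values on
   negative arguments are irrelevant. *)
Record calibration_function (R : realType) (rho : R -> R) : Prop := {
  calib_ge0 : forall t, 0 <= t -> 0 <= rho t ;
  calib_continuous : {within `[0, +oo[, continuous rho} ;
  calib_increasing : forall s t, 0 <= s -> s < t -> rho s < rho t ;
  calib_unbounded : forall M, exists2 t, 0 <= t & M < rho t ;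
  calib_lipschitz : forall s t, 0 <= s -> 0 <= t ->
    `|rho s - rho t| <= `|s - t| ;
  calib_concave : forall s t a, 0 <= s -> 0 <= t -> 0 <= a <= 1 ->
    a * rho s + (1 - a) * rho t <= rho (a * s + (1 - a) * t) ;
  calib_slope : forall s t, 0 < s -> s <= t -> rho t / t <= rho s / s ;
  calib0 : rho 0 = 0
}.

Definition calib_inv (R : realType) (rho : R -> R) : R -> R :=
  'pinv_(fun=> 0) `[0, +oo[ rho.

Lemma calib_invK (R : realType) (rho : R -> R) : calibration_function rho ->
  forall t, 0 <= t -> calib_inv rho (rho t) = t.
Proof.
move=> rhoP t t0; apply: pinvKV; last by rewrite inE/= in_itv/= t0.
move=> x y; rewrite !inE/= !in_itv/= !andbT => x0 y0 xy.
case: (ltgtP x y) => // lt.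
- by have := calib_increasing rhoP x0 lt; rewrite xy ltxx.
- by have := calib_increasing rhoP y0 lt; rewrite xy ltxx.
Qed.

Lemma calib_invP (R : realType) (rho : R -> R) : calibration_function rho ->
  forall y, 0 <= y -> 0 <= calib_inv rho y /\ rho (calib_inv rho y) = y.
Proof.
move=> rhoP y y0; have [t t0 yt] := calib_unbounded rhoP y.
have ct : {within `[0, t], continuous rho}.
  apply: continuous_subspaceW (calib_continuous rhoP).
  by move=> z /=; rewrite !in_itv/= andbT => /andP[].
have [|c] := @IVT R rho 0 t y t0 ct.
  by rewrite (calib0 rhoP) ge_min y0/= le_max (ltW yt) orbT.
by rewrite in_itv/= => /andP[c0 _] <-; rewrite calib_invK.
Qed.

Definition calib_u (R : realType) (rho : R -> R) (k : nat) : nat :=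
  Num.truncn (calib_inv rho k%:R).

(* A is regarded as a set of positive integers: 0 is never counted. *)
Definition lower_density (R : realType) (rho : R -> R) (A : set nat) : \bar R :=
  limn_einf (fun N : nat =>
    ((\sum_(1 <= n < N.+1) (n \in A))%N%:R / rho N%:R)%:E).

Definition frequently_hypercyclic (R : realType) (rho : R -> R)
    (K : numFieldType) (X : tvsType K) (T : {linear X -> X}) : Prop :=
  continuous T /\
  exists x : X, forall U : set X, open U -> U !=set0 ->
    (0 < lower_density rho [set n | U (iter n T x)])%E.

Variant scalar_kind := RealScalars | ComplexScalars.

Section scalars.
Context (R : realType) (F : scalar_kind).

Definition scalars : numFieldType :=
  match F with RealScalars => R : numFieldType | ComplexScalars => R[i] end.

Definition scalar_of_real : R -> scalars :=
  match F return R -> match F with RealScalars => R : numFieldType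
                                 | ComplexScalars => R[i] end with
  | RealScalars => id
  | ComplexScalars => real_complex R
  end.

(* The norm `|z| of the numFieldType [scalars] takes its values in [scalars];
   this is the same absolute value as an element of R. *)
Definition absr : scalars -> R :=
  match F return match F with RealScalars => R : numFieldType
                            | ComplexScalars => R[i] end -> R with
  | RealScalars => Num.norm
  | ComplexScalars => @Normc.normc R
  end.

Lemma scalar_of_real_absr z : scalar_of_real (absr z) = `|z|.
Proof. by move: z; rewrite /scalar_of_real /absr /scalars; case: F. Qed.

Lemma scalar_of_realD a b :
  scalar_of_real (a + b) = scalar_of_real a + scalar_of_real b.
Proof.
by rewrite /scalar_of_real /scalars; case: F => //=; rewrite rmorphD.
Qed.

Lemma scalar_of_realM a b :
  scalar_of_real (a * b) = scalar_of_real a * scalar_of_real b.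
Proof.
by rewrite /scalar_of_real /scalars; case: F => //=; rewrite rmorphM.
Qed.

Lemma scalar_of_real0 : scalar_of_real 0 = 0.
Proof. by rewrite /scalar_of_real /scalars; case: F. Qed.

Lemma scalar_of_real_le a b :
  (scalar_of_real a <= scalar_of_real b) = (a <= b).
Proof.
by rewrite /scalar_of_real /scalars; case: F => //=; rewrite lecR.
Qed.

Lemma scalar_of_real_inj : injective scalar_of_real.
Proof. by move=> a b ab; apply/eqP; rewrite eq_le -!scalar_of_real_le ab lexx. Qed.

Lemma absr_ge0 z : 0 <= absr z.
Proof. by rewrite -scalar_of_real_le scalar_of_real0 scalar_of_real_absr. Qed.

Lemma absr0 : absr 0 = 0.
Proof.
by apply: scalar_of_real_inj; rewrite scalar_of_real_absr normr0 scalar_of_real0.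
Qed.

Lemma absr0_eq0 z : absr z = 0 -> z = 0.
Proof.
move=> z0; apply/eqP; rewrite -normr_eq0 -scalar_of_real_absr z0.
by rewrite scalar_of_real0.
Qed.

Lemma absrM y z : absr (y * z) = absr y * absr z.
Proof.
by apply: scalar_of_real_inj; rewrite scalar_of_realM !scalar_of_real_absr normrM.
Qed.

Lemma absrD y z : absr (y + z) <= absr y + absr z.
Proof.
rewrite -scalar_of_real_le scalar_of_realD !scalar_of_real_absr.
exact: ler_normD.
Qed.

Lemma absr_real a : absr (scalar_of_real a) = `|a|.
Proof.
rewrite /absr /scalar_of_real /scalars; case: F => //=.
by rewrite expr0n/= addr0 sqrtr_sqr.
Qed.

End scalars.

Section lp_norm.
Context (R : realType) (F : scalar_kind) (p : R) (p1 : 1 <= p).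
Local Notation K := (scalars R F).
Local Open Scope ereal_scope.

Definition lp_norm (x : nat -> K^o) : \bar R :=
  'N[counting]_(p%:E)[EFin \o (@absr R F \o x)].

Let p_gt0 : (0 < p)%R. Proof. exact: lt_le_trans p1. Qed.

Lemma lp_normE x :
  lp_norm x = (\sum_(n <oo) (absr (x n) `^ p)%:E) `^ p^-1.
Proof.
rewrite /lp_norm Lnorm_counting//; congr (_ `^ _).
by apply: eq_eseriesr => n _; rewrite gee0_abs ?lee_fin ?absr_ge0.
Qed.

Lemma lp_norm_ge0 x : 0 <= lp_norm x.
Proof. exact: Lnorm_ge0. Qed.

Lemma le_lp_norm (x y : nat -> K^o) :
  (forall n, (absr (x n) <= absr (y n))%R) -> lp_norm x <= lp_norm y.
Proof.
move=> xy; rewrite !lp_normE; apply: gt0_ler_poweR.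
- by rewrite invr_ge0 ltW.
- by rewrite in_itv/= leey andbT; apply: nneseries_ge0 => n _; rewrite lee_fin powR_ge0.
- by rewrite in_itv/= leey andbT; apply: nneseries_ge0 => n _; rewrite lee_fin powR_ge0.
- apply: lee_nneseries => [n _ _|n _]; first by rewrite lee_fin powR_ge0.
  by rewrite lee_fin ge0_ler_powR ?nnegrE ?absr_ge0// ltW.
Qed.

Lemma le_coord_lp_norm x n : (absr (x n))%:E <= lp_norm x.
Proof.
have -> : (absr (x n))%:E = ((absr (x n) `^ p)%:E) `^ p^-1.
  by rewrite poweR_EFin -powRrM mulfV ?gt_eqF// powRr1// absr_ge0.
rewrite lp_normE; apply: gt0_ler_poweR.
- by rewrite invr_ge0 ltW.
- by rewrite in_itv/= leey andbT lee_fin powR_ge0.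
- by rewrite in_itv/= leey andbT; apply: nneseries_ge0 => k _; rewrite lee_fin powR_ge0.
- rewrite (nneseriesD1 _ (n := n))//; last first.
    by move=> k _; rewrite lee_fin powR_ge0.
  by rewrite leeDl//; apply: nneseries_ge0 => k _ _; rewrite lee_fin powR_ge0.
Qed.

Lemma lp_norm_eq0 x : lp_norm x = 0 -> x = 0%R.
Proof.
move=> x0; apply/funext => n; apply/absr0_eq0/eqP.
by rewrite eq_le absr_ge0 andbT -lee_fin (le_trans (le_coord_lp_norm _ _))// x0.
Qed.

Lemma lp_norm0 : lp_norm 0%R = 0.
Proof.
rewrite lp_normE eseries0 ?poweR0r ?invr_neq0 ?gt_eqF// => n _ _.
by rewrite absr0 powR0// gt_eqF.
Qed.

Lemma lp_normZ (a : K) (x : nat -> K^o) :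
  lp_norm (a *: x)%R = (absr a)%:E * lp_norm x.
Proof.
have absp_ge0 n : 0 <= (absr (x n) `^ p)%:E by rewrite lee_fin powR_ge0.
rewrite !lp_normE.
rewrite [X in X `^ _ = _](_ : _ =
    (absr a `^ p)%:E * \sum_(n <oo) (absr (x n) `^ p)%:E); last first.
  rewrite -nneseriesZl//; apply: eq_eseriesr => n _.
  by rewrite -EFinM -powRM ?absr_ge0// -absrM.
rewrite poweRM ?lee_fin ?powR_ge0 ?nneseries_ge0//.
by rewrite poweR_EFin -powRrM mulfV ?gt_eqF// powRr1// absr_ge0.
Qed.

Lemma lp_normD (x y : nat -> K^o) : lp_norm (x + y)%R <= lp_norm x + lp_norm y.
Proof.
have mnat (f : nat -> R) : measurable_fun [set: nat] f by [].
pose f n := absr (x n); pose g n := absr (y n).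
apply: (@le_trans _ _ 'N[counting]_(p%:E)[EFin \o (f \+ g)%R]); last first.
  exact: (minkowski_EFin counting (mnat f) (mnat g) p1).
rewrite lp_normE Lnorm_counting//; apply: gt0_ler_poweR.
- by rewrite invr_ge0 ltW.
- by rewrite in_itv/= leey andbT; apply: nneseries_ge0 => n _; rewrite lee_fin powR_ge0.
- by rewrite in_itv/= leey andbT; apply: nneseries_ge0 => n _ _; rewrite lee_fin powR_ge0.
- apply: lee_nneseries => [n _ _|n _]; first by rewrite lee_fin powR_ge0.
  have fg0 : (0 <= f n + g n)%R by rewrite addr_ge0// absr_ge0.
  rewrite /= ger0_norm// lee_fin.
  by rewrite ge0_ler_powR ?nnegrE ?absr_ge0 ?absrD// ltW.
Qed.

Lemma lp_norm_behead (x : nat -> K^o) : lp_norm (fun n => x n.+1) <= lp_norm x.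
Proof.
have absp_ge0 n : 0 <= (absr (x n) `^ p)%:E by rewrite lee_fin powR_ge0.
rewrite !lp_normE; apply: gt0_ler_poweR.
- by rewrite invr_ge0 ltW.
- by rewrite in_itv/= leey andbT; exact: nneseries_ge0.
- by rewrite in_itv/= leey andbT; exact: nneseries_ge0.
- rewrite [leRHS]nneseries_recl// -(nneseries_addn 1)//.
  under eq_eseriesr do rewrite -addn1.
  by rewrite leeDr.
Qed.

End lp_norm.

Section lp_space.
Context (R : realType) (F : scalar_kind) (p : R).
Local Notation K := (scalars R F).

Definition lp_pred : {pred nat -> K^o} := mem [set x | (lp_norm p x < +oo)%E].

(* p1 does not occur in the fields; it records in the type the assumption
   under which [lp_norm] is a norm. *)
Record lp (p1 : 1 <= p) : Type := Lp {
  lp_val :> nat -> K^o ;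
  lp_valP : lp_val \in lp_pred
}.

Context (p1 : 1 <= p).

HB.instance Definition _ := [isSub for @lp_val p1].
HB.instance Definition _ := [Choice of lp p1 by <:].

Lemma lp_submod_closed : submod_closed lp_pred.
Proof.
split; first by rewrite inE/= lp_norm0.
move=> a x y; rewrite !inE/= => xoo yoo.
rewrite (le_lt_trans (lp_normD p1 _ _))// lte_add_pinfty// lp_normZ//.
by rewrite lte_mul_pinfty// lee_fin absr_ge0.
Qed.

#[local] HB.instance Definition _ :=
  GRing.isSubmodClosed.Build K (nat -> K^o) lp_pred lp_submod_closed.
HB.instance Definition _ := [SubChoice_isSubLmodule of lp p1 by <:].

Definition lp_normr (x : lp p1) : R := fine (lp_norm p x).

Lemma lp_normrE (x : lp p1) : (lp_normr x)%:E = lp_norm p x.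
Proof.
rewrite fineK// ge0_fin_numE ?lp_norm_ge0//.
by have := lp_valP x; rewrite inE.
Qed.

Let norm (x : lp p1) : K := scalar_of_real F (lp_normr x).

Let ler_normD (x y : lp p1) : norm (x + y) <= norm x + norm y.
Proof.
rewrite -scalar_of_realD scalar_of_real_le -lee_fin EFinD !lp_normrE.
exact: lp_normD.
Qed.

Let normrZ (a : K) (x : lp p1) : norm (a *: x) = `|a| * norm x.
Proof.
rewrite -scalar_of_real_absr -scalar_of_realM; congr scalar_of_real.
by apply: EFin_inj; rewrite EFinM !lp_normrE -lp_normZ.
Qed.

Let normr0_eq0 (x : lp p1) : norm x = 0 -> x = 0.
Proof.
rewrite -(scalar_of_real0 R F) => /scalar_of_real_inj x0; apply: val_inj => /=.
by apply: (lp_norm_eq0 p1); rewrite -lp_normrE x0.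
Qed.

HB.instance Definition _ :=
  Lmodule_isNormed.Build K (lp p1) ler_normD normrZ normr0_eq0.

Lemma lp_normedE (x : lp p1) : `|x| = scalar_of_real F (lp_normr x).
Proof. by []. Qed.

End lp_space.

(* The weight sequence is (w 1, w 2, ...); the value w 0 is never used. *)
Definition bounded_weights (R : realType) (w : nat -> R) : Prop :=
  exists M, forall n, (0 < n)%N -> `|w n| <= M.

Section weighted_shift.
Context (R : realType) (F : scalar_kind) (p : R) (p1 : 1 <= p).
Context (w : nat -> R) (wb : bounded_weights w).
Local Notation K := (scalars R F).

Definition wshift_fun (x : nat -> K^o) : nat -> K^o :=
  fun n => scalar_of_real F (w n.+1) * x n.+1.

Lemma lp_norm_wshift_fun M x : (forall n, (0 < n)%N -> `|w n| <= M) ->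
  (lp_norm p (wshift_fun x) <= M%:E * lp_norm p x)%E.
Proof.
move=> wM; have M0 : 0 <= M by apply: le_trans (wM 1%N isT).
have absM : absr (scalar_of_real F M) = M by rewrite absr_real ger0_norm.
apply: (@le_trans _ _ (M%:E * lp_norm p (fun n => x n.+1))%E); last first.
  by rewrite lee_wpmul2l ?lee_fin// lp_norm_behead.
rewrite -{1}absM -lp_normZ//; apply: le_lp_norm => // n.
by rewrite !absrM absM absr_real ler_wpM2r ?absr_ge0// wM.
Qed.

Lemma wshift_subproof (x : lp F p1) : wshift_fun x \in @lp_pred R F p.
Proof.
case: wb => M wM; rewrite inE/=; apply: (le_lt_trans (lp_norm_wshift_fun _ wM)).
by rewrite -lp_normrE -EFinM ltry.
Qed.

Definition wshift (x : lp F p1) : lp F p1 := Lp p1 (wshift_subproof x).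

Lemma wshift_is_linear : linear wshift.
Proof.
move=> a x y; apply: val_inj; apply/funext => n /=.
by rewrite /wshift_fun /= mulrDr; congr (_ + _); rewrite mulrCA.
Qed.

HB.instance Definition _ :=
  GRing.isLinear.Build K (lp F p1) (lp F p1) *:%R wshift wshift_is_linear.

End weighted_shift.
Arguments wshift {R} F {p} p1 {w} wb x.

Definition weight_alpha (R : realType) (w : nat -> R) (n : nat) : R :=
  (\prod_(1 <= m < n.+1) w m)^-1.

(* Main.v *)
Require Import Defs.
From mathcomp Require Import all_boot all_order all_algebra complex.
From mathcomp Require Import all_classical all_reals all_analysis.
From mathcomp Require Import zify lra ring.

(** Write the vector as x_n = alpha_n z_n. Then the n-th coordinate of B^s x is
    alpha_n z_(n+s), so the problem becomes: find a sequence z with finite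
    weighted norm (sum_n alpha_n^p |z_n|^p)^(1/p) whose unweighted shifts come
    close, often enough, to each member of a countable dense family of finitely
    supported sequences P_0, P_1, ...

    The sequence z is obtained by writing the block P_i at the position u_k for
    each k in a set K_i. Shifting by u_k with k in K_i puts P_i at the origin;
    the error consists of the blocks written at later positions u_(k+l), whose
    entries m are now at m + (u_(k+l) - u_k). By hypothesis the sum of
    alpha^p over these places is a tail of a series that converges uniformly
    in k, hence it is small provided that l is large in terms of the indices i
    of both blocks. So the sets K_i have to satisfy two requirements: elements of
    K_i and K_i' are at distance at least max(g_i, g_i'), where the gaps g_i
    grow as fast as needed, and each K_i has positive lower density
    ([block_start_sep], [block_start_dense]). With such sets the total error for
    class i is at most 2 * 2^-i ([splice_return]); since every target occurs
    with arbitrarily large i, all targets are approximated arbitrarily well.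

    Finally u_k <= N whenever k <= rho(N), and k |-> u_k is strictly increasing
    because rho is 1-Lipschitz, so that positive lower density of K_i gives
    positive lower rho-density of the set of return times u_k, k in K_i
    ([blocks_lower_density]). *)

Set Implicit Arguments.
Unset Strict Implicit.
Unset Printing Implicit Defensive.

Import Order.TTheory GRing.Theory Num.Theory.
Import numFieldNormedType.Exports.
Local Open Scope classical_set_scope.
Local Open Scope ring_scope.

(** * Separated sets of indices of positive lower density *)

Lemma logn2_odd i b : logn 2 (2 ^ i * b.*2.+1) = i.
Proof.
rewrite lognM ?expn_gt0// pfactorK// (_ : logn 2 b.*2.+1 = 0)%N ?addn0//.
by rewrite lognE/= dvdn2 /= odd_double.
Qed.

Section blocks.
Variable E : nat -> nat.
Implicit Types k n i t : nat.
Local Open Scope nat_scope.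

(** The dyadic window [2^t, 2^t.+1[ is given to the class [logn 2 t], so that
    the windows of one class recur with t increasing by a constant: consecutive
    ones have a bounded ratio, whatever the number of competing classes. *)
Definition block_class k := logn 2 (trunc_log 2 k).

(** The indices k whose position u_k carries a block of class [block_class k].
    The distance 2 ^ E i to both ends of the window separates classes living in
    different windows. *)
Definition block_start k :=
  let t := trunc_log 2 k in let d := 2 ^ E (block_class k) in
  [&& d %| k, 2 ^ t + d <= k & k + d <= 2 ^ t.+1].

Lemma block_start_gt k : block_start k -> 2 ^ E (block_class k) < k.
Proof.
case/and3P => _ + _; apply: leq_trans.
by rewrite -[ltnLHS]add0n ltn_add2r expn_gt0.
Qed.

Lemma block_class_le k : block_class k <= k.
Proof.
rewrite /block_class; case: (posnP (trunc_log 2 k)) => [->|t0].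
  by rewrite logn0.
apply: leq_trans (ltnW (ltn_logl 2 t0)) _.
case: (posnP k) => [->//|k0].
by rewrite (leq_trans (ltnW (ltn_expl _ (isT : 1 < 2))))// trunc_logP.
Qed.

(** Two starts in the same window are multiples of the same 2 ^ E i; two starts
    in different windows are each far from the common boundary. *)
Lemma block_start_sep k k' : block_start k -> block_start k' -> k < k' ->
  k + maxn (2 ^ E (block_class k)) (2 ^ E (block_class k')) <= k'.
Proof.
move=> sk sk' kk'; move: (sk) (sk') => /and3P[d1 l1 r1] /and3P[d2 l2 r2].
have [tt'|tt'|tt'] := ltngtP (trunc_log 2 k) (trunc_log 2 k').
- rewrite addn_maxr geq_max.
  have : 2 ^ (trunc_log 2 k).+1 <= 2 ^ trunc_log 2 k' by rewrite leq_exp2l.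
  by lia.
- by have := leq_trunc_log 2 (ltnW kk'); rewrite leqNgt tt'.
- have cE : block_class k = block_class k' by rewrite /block_class tt'.
  rewrite cE maxnn -leq_subRL; last exact: ltnW.
  by rewrite dvdn_leq ?subn_gt0// dvdn_sub// -cE.
Qed.

(** The starts of class i have positive lower density: among the windows
    contained in [1, n], the last one of class i takes up at least the fraction
    2^-(2^i.+1 + 1) of that interval, and its starts form an arithmetic
    progression of step 2 ^ E i. The progression [f] is exhibited, rather than
    counted, because it is later transported by k |-> u_k. *)
Lemma block_start_dense i : exists c n0, forall n, n0 <= n ->
  exists M (f : nat -> nat), [/\ {homo f : a b / a < b}, n < c * M &
    forall q, q < M ->
      [/\ block_start (f q), block_class (f q) = i & 0 < f q <= n]].
Proof.
exists (2 ^ (E i + 2 + 2 ^ i.+1)), (2 ^ (2 ^ i + 2 ^ i.+1 + E i + 2)) => n n0n.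
have n_gt0 : 0 < n by apply: leq_trans n0n; rewrite expn_gt0.
have := trunc_log_max (isT : 1 < 2) n0n.
have := trunc_log_ltn n (isT : 1 < 2).
have := trunc_logP (isT : 1 < 2) n_gt0.
set r := trunc_log 2 n => rn nr rL.
have P0 : 0 < 2 ^ i.+1 by rewrite expn_gt0.
(* t is the largest exponent of class i, i.e. of the form 2^i(2b+1), below r. *)
pose b := (r - 1 - 2 ^ i) %/ 2 ^ i.+1; pose t := 2 ^ i * b.*2.+1.
have [tr rt] : t.+1 <= r /\ r <= t + 2 ^ i.+1.
  have := divn_eq (r - 1 - 2 ^ i) (2 ^ i.+1).
  have := ltn_pmod (r - 1 - 2 ^ i) P0.
  rewrite -/b /t -mul2n expnS => *; split; nia.
have tE : E i < t by lia.
pose s := t - (E i).+1; have tsE : t = E i + s.+1 by rewrite /s; lia.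
have ti : logn 2 t = i by rewrite logn2_odd.
exists (2 ^ s), (fun q => 2 ^ E i * (2 ^ s.+1 + q.+1)); split.
- by move=> a a' aa'; rewrite ltn_pmul2l ?expn_gt0// ltn_add2l.
- rewrite -expnD (leq_trans nr)// leq_exp2l//; lia.
- move=> q qs.
  have s0 : 0 < 2 ^ s by rewrite expn_gt0.
  have e0 : 0 < 2 ^ E i by rewrite expn_gt0.
  have t2 : 2 ^ t = 2 ^ E i * 2 ^ s.+1 by rewrite tsE expnD.
  have s2 : 2 ^ s.+1 = 2 * 2 ^ s by rewrite expnS.
  have fqE : trunc_log 2 (2 ^ E i * (2 ^ s.+1 + q.+1)) = t.
    apply: trunc_log_eq => //; rewrite [2 ^ t.+1]expnS t2.
    by apply/andP; split; nia.
  rewrite /block_start /block_class fqE ti dvdn_mulr//=; split => //.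
    by rewrite [2 ^ t.+1]expnS t2; apply/andP; split; nia.
  rewrite muln_gt0 e0 addnS ltn0Sn/= (leq_trans _ rn)//.
  apply: (@leq_trans (2 ^ t.+1)); last by rewrite leq_exp2l.
  by rewrite [2 ^ t.+1]expnS t2; nia.
Qed.

End blocks.

(** * Splicing blocks along an increasing sequence of positions *)

Lemma ler_term_sum_nat (R : numDomainType) (f : nat -> R) m n j :
  (forall i, 0 <= f i) -> (m <= j < n)%N -> f j <= \sum_(m <= i < n) f i.
Proof.
move=> f0 mjn; rewrite (big_rem j) ?mem_index_iota//=.
by rewrite lerDl sumr_ge0.
Qed.

Lemma sum_geometric_half (R : realFieldType) i J :
  \sum_(i <= j < J) (2^-1 ^+ j : R) <= 2 * 2^-1 ^+ i.
Proof.
have [Ji|iJ] := leqP J i.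
  by rewrite big_geq// mulr_ge0// exprn_ge0// invr_ge0.
suff -> : \sum_(i <= j < J) (2^-1 ^+ j : R) = 2 * 2^-1 ^+ i - 2 * 2^-1 ^+ J.
  by rewrite lerBlDr lerDl mulr_ge0// exprn_ge0// invr_ge0.
elim: J iJ => // J IH; rewrite ltnS leq_eqVlt => /predU1P[->|iJ].
  by rewrite big_nat1 exprS; field.
rewrite big_nat_recr ?(ltnW iJ)//= IH// [2^-1 ^+ J.+1]exprS.
by move: (2^-1 ^+ J) (2^-1 ^+ i) => x y; field.
Qed.

(** The functions [phi] and [a] stand for c |-> |c|^p and n |-> alpha_n^p;
    the blocks do not overlap, so that no sum is ever split inside [phi]. The
    number [D j] bounds the lengths and the heights of
    the blocks P_0, ..., P_j, and the gap 2 ^ E j is so large that blocks of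
    size D j placed at distance at least [E j] contribute at most 2^-j. *)
Section splice.
Variables (R : realType) (V : zmodType) (phi : V -> R).
Hypothesis phi0 : phi 0 = 0.
Variables (a : nat -> R) (u : nat -> nat).
Hypotheses (a_ge0 : forall n, 0 <= a n) (u_incr : {homo u : m n / (m < n)%N}).
Variables (P : nat -> seq V) (E D : nat -> nat).
Hypothesis size_D : forall i j, (i <= j)%N -> (size (P i) <= D j)%N.
Hypothesis phi_D : forall i j m, (i <= j)%N -> phi (nth 0 (P i) m) <= (D j)%:R.
Hypothesis D_E : forall j, (D j <= 2 ^ E j)%N.
Hypothesis tail_E : forall j k Q, (D j)%:R * (\sum_(E j <= l < Q)
  \sum_(0 <= m < D j) a (m + (u (k + l) - u k))) <= 2^-1 ^+ j.

(** The value 0, taken when no start precedes n, is not a start itself. *)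
Definition last_start n :=
  (\max_(k < n.+1 | block_start E k && (u k <= n)%N) k)%N.

Definition splice n : V := let k := last_start n in
  if block_start E k then nth 0 (P (block_class k)) (n - u k) else 0.

Let u_ge k : (k <= u k)%N.
Proof. by elim: k => // k IH; exact: leq_ltn_trans IH (u_incr (ltnSn k)). Qed.

Lemma last_startP n : last_start n = 0%N \/
  block_start E (last_start n) /\ (u (last_start n) <= n)%N.
Proof.
rewrite /last_start; elim/big_ind: _ => [|x y hx hy|k /andP[? ?]].
- by left.
- by rewrite /maxn; case: ifP.
- by right.
Qed.

Lemma last_start_ge n k : block_start E k -> (u k <= n)%N ->
  (k <= last_start n)%N.
Proof.
move=> sk ukn; have kn : (k < n.+1)%N by rewrite ltnS (leq_trans (u_ge k)).
by rewrite /last_start (@leq_bigmax_cond _ _ _ (Ordinal kn)) ?sk.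
Qed.

(** The error between the shift of the spliced sequence by u_k and the block s
    that it shows at the origin comes from the blocks at later starts
    k' = k + l. If such a block has class i', its entry m is met at
    n = m + (u_(k+l) - u_k), and the gap forces l >= E_j for j = max(i, i'), so
    that it is counted in the j-th tail with j >= i; the tails sum up to at most
    2 * 2^-i. Both a start k of class i, with s = P_i, and k = 0, with s empty,
    are of this form. *)
Lemma splice_tail k i s :
    (forall k', block_start E k' -> (k < k')%N ->
      (k + maxn (size s) (2 ^ E (maxn i (block_class k'))) <= k')%N) ->
    (forall n, (u k <= n)%N -> (k <= last_start n)%N) ->
    (forall n, last_start n = k -> splice n = nth 0 s (n - u k)) ->
  forall Q, \sum_(0 <= n < Q) a n * phi (splice (n + u k) - nth 0 s n)
    <= 2 * 2^-1 ^+ i.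
Proof.
move=> gap lastk splicek Q.
pose J := (i + k + Q + u k).+1%N.
(* hit j l m n majorizes the entry m of a block at k + l, as seen from k. *)
pose hit j l m n : R := (D j)%:R * (n == m + (u (k + l) - u k))%N%:R.
have hit_ge0 j l m n : 0 <= hit j l m n by rewrite mulr_ge0.
have phi_le n : (n < Q)%N -> phi (splice (n + u k) - nth 0 s n) <=
    \sum_(i <= j < J) \sum_(E j <= l < J) \sum_(0 <= m < D j) hit j l m n.
  move=> nQ.
  have sum_ge0 : 0 <=
      \sum_(i <= j < J) \sum_(E j <= l < J) \sum_(0 <= m < D j) hit j l m n.
    by do 3![apply: sumr_ge0 => ? _].
  (* A single block, the one at k', covers position n + u k. *)
  set k' := last_start (n + u k).
  have kk' : (k <= k')%N by apply: lastk; rewrite leq_addl.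
  have [kE|k'k] := eqVneq k k'.
    by rewrite splicek// addnK subrr phi0.
  have {k'k}kk' : (k < k')%N by rewrite ltn_neqAle k'k.
  have [/eqP|[sk' uk']] := last_startP (n + u k).
    by rewrite -/k' gtn_eqF// (leq_ltn_trans _ kk').
  rewrite -/k' in sk' uk'.
  have := gap _ sk' kk'; set i' := block_class k' => gapk'.
  have k'n : (k' - k <= n)%N.
    have : (u k + (k' - k) <= u k')%N.
      rewrite -{2}(subnKC (ltnW kk')); elim: (k' - k)%N => [|l IH].
        by rewrite !addn0.
      by rewrite !addnS (leq_ltn_trans IH)// u_incr.
    lia.
  have -> : nth 0 s n = 0.
    by rewrite nth_default//; lia.
  rewrite subr0 /splice -/k' sk' -/i'.
  have [big_m|small_m] := leqP (size (P i')) (n + u k - u k').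
    by rewrite nth_default// phi0.
  have i'k' : (i' <= k')%N := block_class_le k'.
  set j := maxn i i'.
  have Ej : (E j <= k' - k)%N.
    have : (2 ^ E j <= k' - k)%N by rewrite /j; lia.
    by apply: leq_trans; exact/ltnW/ltn_expl.
  have jJ : (i <= j < J)%N by rewrite /j /J; lia.
  have lJ : (E j <= k' - k < J)%N by rewrite Ej /J; lia.
  have i'j : (i' <= j)%N by rewrite leq_maxr.
  have mD : (0 <= n + u k - u k' < D j)%N.
    by rewrite (leq_trans small_m)// size_D.
  apply: le_trans (ler_term_sum_nat _ jJ); last first.
    by move=> j'; do 2![apply: sumr_ge0 => ? _].
  apply: le_trans (ler_term_sum_nat _ lJ); last first.
    by move=> l; apply: sumr_ge0 => ? _.
  apply: le_trans (ler_term_sum_nat _ mD) => //.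
  have uu : (u k <= u k')%N by apply/ltnW/u_incr.
  rewrite /hit subnKC ?(ltnW kk')// (_ : (n == _) = true) ?mulr1 ?phi_D//.
  by apply/eqP; lia.
apply: (@le_trans _ _ (\sum_(0 <= n < Q) \sum_(i <= j < J) \sum_(E j <= l < J)
    \sum_(0 <= m < D j) a n * hit j l m n)).
  apply: ler_sum_nat => n /andP[_ nQ].
  apply: le_trans (ler_wpM2l (a_ge0 n) (phi_le _ nQ)) _.
  rewrite mulr_sumr; apply: ler_sum => j _; rewrite mulr_sumr.
  by apply: ler_sum => l _; rewrite mulr_sumr.
(* Summing over n first leaves, for each (j, l, m), only one position n0. *)
rewrite exchange_big/=; apply: le_trans (sum_geometric_half _ i J).
apply: ler_sum => j _; apply: le_trans (tail_E j k J).
rewrite exchange_big mulr_sumr/=; apply: ler_sum => l _.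
rewrite exchange_big mulr_sumr/=; apply: ler_sum => m _.
set n0 := (m + _)%N.
have -> : \sum_(0 <= n < Q) a n * hit j l m n =
    \sum_(0 <= n < Q | n == n0) a n * (D j)%:R.
  rewrite [RHS]big_mkcond/=; apply: eq_bigr => n _.
  by rewrite /hit -/n0; case: eqP => _; rewrite ?mulr1 ?mulr0.
rewrite big_nat1_eq mulrC; case: ifP => // _.
by rewrite mulr_ge0.
Qed.

Lemma splice_bounded Q : u 0%N = 0%N ->
  \sum_(0 <= n < Q) a n * phi (splice n) <= 2.
Proof.
move=> u0; rewrite -[leRHS]mulr1 -(expr0 2^-1).
have := @splice_tail 0 0 [::]; rewrite u0 => /(_ _ _ _ Q).
under eq_bigr do rewrite addn0 nth_nil subr0.
apply=> // [k' sk' _|n n0].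
- by rewrite !max0n add0n; exact/ltnW/block_start_gt.
- by rewrite /splice n0 nth_nil; case: ifP => // /block_start_gt.
Qed.

Lemma splice_return k i : block_start E k -> block_class k = i ->
  forall Q, \sum_(0 <= n < Q) a n * phi (splice (n + u k) - nth 0 (P i) n)
    <= 2 * 2^-1 ^+ i.
Proof.
move=> sk ki; apply: splice_tail.
- move=> k' sk' kk'; have := block_start_sep sk sk' kk'; rewrite ki.
  have : (size (P i) <= 2 ^ E i)%N by apply: leq_trans (D_E i); exact: size_D.
  have [] := leqP i (block_class k') => _.
    by move: (2 ^ E i)%N (2 ^ E _)%N (size _) => x y z; lia.
  by move: (2 ^ E i)%N (2 ^ E _)%N (size _) => x y z; lia.
- by move=> n; exact: last_start_ge.
- by move=> n nk; rewrite /splice nk sk ki.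
Qed.

End splice.

(** * Positions given by a calibration function *)

Section calibration.
Variables (R : realType) (rho : R -> R).
Hypothesis rho_calib : calibration_function rho.
Local Notation u := (calib_u rho).

Lemma calib_le s t : 0 <= s -> s <= t -> rho s <= rho t.
Proof.
move=> s0; rewrite le_eqVlt => /predU1P[->//|st].
exact/ltW/(calib_increasing rho_calib).
Qed.

Lemma calib_u0 : u 0 = 0%N.
Proof.
by rewrite /calib_u -[0%:R](calib0 rho_calib) (calib_invK rho_calib) ?truncn0.
Qed.

(** A 1-Lipschitz rho has an inverse that increases by at least 1 on each unit
    interval, and integer parts preserve this. *)
Lemma calib_u_incr : {homo u : m n / (m < n)%N}.
Proof.
apply: homo_ltn => [? ? ?|k]; first exact: ltn_trans.
have [s0 sk] := calib_invP rho_calib (ler0n R k).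
have [t0 tk] := calib_invP rho_calib (ler0n R k.+1).
rewrite /calib_u; set s := calib_inv rho k%:R in s0 sk *.
set t := calib_inv rho k.+1%:R in t0 tk *.
rewrite truncn_gt_nat.
have st : s <= t.
  rewrite leNgt; apply/negP => /ltW/(calib_le t0).
  by rewrite sk tk ler_nat ltnn.
have := calib_lipschitz rho_calib t0 s0; rewrite sk tk -natrB// subSnn normr1.
rewrite ger0_norm ?subr_ge0// lerBrDl => /(le_trans _); apply.
by rewrite -natr1 lerD2r truncn_le.
Qed.

Lemma calib_u_le k N : k%:R <= rho N%:R -> (u k <= N)%N.
Proof.
move=> kN; have [s0 sk] := calib_invP rho_calib (ler0n R k).
rewrite -(ler_nat R) (le_trans (y := calib_inv rho k%:R)) ?truncn_le//.
rewrite leNgt; apply/negP => /(calib_increasing rho_calib (ler0n R N)).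
by rewrite sk ltNge kN.
Qed.

End calibration.

Lemma limn_einf_gt0 (R : realType) (v : nat -> R) (c : R) n0 : 0 < c ->
  (forall n, (n0 <= n)%N -> c <= v n) -> (0 < limn_einf (fun n => (v n)%:E))%E.
Proof.
move=> c0 cv; rewrite limn_einf_lim (cvg_lim _ (@cvg_einfs_sup _ _))//.
apply: (@lt_le_trans _ _ c%:E); first by rewrite lte_fin.
apply: le_trans (ereal_sup_ubound _); last by exists n0.
by apply: le_ereal_inf_tmp => _ /= [n /= n0n <-]; rewrite lee_fin cv.
Qed.

Lemma leq_count_image (A : set nat) (f : nat -> nat) M N :
    {homo f : m n / (m < n)%N} ->
    (forall q, (q < M)%N -> A (f q) /\ (0 < f q <= N)%N) ->
  (M <= \sum_(1 <= n < N.+1) (n \in A))%N.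
Proof.
move=> f_incr fA.
have -> : (\sum_(1 <= n < N.+1) (n \in A) =
    count (mem A) (index_iota 1 N.+1))%N.
  rewrite -sum1_count [RHS]big_mkcond/=; apply: eq_bigr => n _.
  by case: (n \in A).
rewrite -size_filter.
rewrite -(size_iota 0 M) -(size_map f); apply: uniq_leq_size.
  rewrite map_inj_uniq ?iota_uniq// => m n.
  by have [/f_incr|/f_incr|//] := ltngtP m n => + e; rewrite e ltnn.
move=> n /mapP[q]; rewrite mem_iota => /andP[_ qM] ->{n}.
have [Aq fq] := fA q qM.
by rewrite mem_filter mem_index_iota ltnS fq andbT; apply/mem_set.
Qed.

(** Since u_k <= N as soon as k <= rho(N), a set of indices k of positive lower
    density gives a set of positions u_k of positive lower rho-density. *)
Lemma blocks_lower_density (R : realType) (rho : R -> R) (E : nat -> nat)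
    (A : set nat) i : calibration_function rho ->
    (forall k, block_start E k -> block_class k = i -> A (calib_u rho k)) ->
  (0 < lower_density rho A)%E.
Proof.
move=> rho_calib startA; have [c [n0 dense]] := block_start_dense E i.
have [t0 t0_ge0 n0t0] := calib_unbounded rho_calib n0%:R.
have c0 : (0 < c)%N.
  by have [M [f [_ + _]]] := dense n0 (leqnn n0); case: (c).
apply: (@limn_einf_gt0 _ _ c%:R^-1 (Num.truncn t0).+1).
  by rewrite invr_gt0 ltr0n.
move=> N tN.
have t0N : t0 <= N%:R.
  by apply: le_trans (ltW (truncnS_gt t0)) _; rewrite ler_nat.
have rhoN : n0%:R < rho N%:R.
  exact: lt_le_trans n0t0 (calib_le rho_calib _ _).
have rhoN0 : 0 < rho N%:R by apply: le_lt_trans rhoN.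
have [|M [f [f_incr cM fP]]] := dense (Num.truncn (rho N%:R)).
  by rewrite truncn_ge_nat ltW.
rewrite ler_pdivlMr// mulrC ler_pdivrMr ?ltr0n//.
apply: (@le_trans _ _ (c * M)%:R).
  by apply: le_trans (ltW (truncnS_gt _)) _; rewrite ler_nat.
rewrite mulnC natrM ler_wpM2r// ler_nat.
apply: (@leq_count_image _ (calib_u rho \o f)).
  by move=> m n mn; apply: calib_u_incr => //; exact: f_incr.
move=> q /fP[sq cq /andP[q0 qN]]; split; first exact: startA.
rewrite /= (calib_u_le rho_calib) ?andbT; last first.
  by rewrite -truncn_ge_nat ?ltW.
by have := calib_u_incr rho_calib q0; rewrite (calib_u0 rho_calib).
Qed.

(** * Uniformly small tails *)

Section uniform_tails.
Variable R : realType.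
Implicit Types g h : nat -> nat -> R.

(** Finite sums are used instead of series: for nonnegative terms this says that
    the series over l converge uniformly in k. *)
Definition unif_tail g := forall eps : R, 0 < eps ->
  exists N, forall k Q, \sum_(N <= l < Q) g k l <= eps.

Lemma ler_sum_tail (f : nat -> R) N N' Q : (forall l, 0 <= f l) ->
  (N <= N')%N -> \sum_(N' <= l < Q) f l <= \sum_(N <= l < Q) f l.
Proof.
move=> f0 NN'; have [QN'|N'Q] := leqP Q N'.
  by rewrite [leLHS]big_geq// sumr_ge0.
by rewrite [leRHS](big_cat_nat NN' (ltnW N'Q))/= lerDr sumr_ge0.
Qed.

Lemma unif_tail_le g h C : 0 <= C -> (forall k l, g k l <= C * h k l) ->
  unif_tail h -> unif_tail g.
Proof.
move=> C0 gh th eps eps0.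
have [N hN] := th (eps / (C + 1)) (divr_gt0 eps0 (ltr_wpDl C0 ltr01)).
exists N => k Q; apply: (@le_trans _ _ (C * (eps / (C + 1)))).
  apply: le_trans (ler_wpM2l C0 (hN k Q)).
  by rewrite mulr_sumr; apply: ler_sum.
by rewrite mulrCA ler_piMr ?(ltW eps0)// ler_pdivrMr ?ltr_wpDl// mul1r lerDl.
Qed.

Lemma unif_tailD g h : (forall k l, 0 <= g k l) -> (forall k l, 0 <= h k l) ->
  unif_tail g -> unif_tail h -> unif_tail (fun k l => g k l + h k l).
Proof.
move=> g0 h0 tg th eps eps0; have eps2 : 0 < eps / 2 by rewrite divr_gt0.
have [N gN] := tg _ eps2; have [N' hN'] := th _ eps2.
exists (maxn N N') => k Q; rewrite big_split/= [leRHS](splitr eps) lerD//.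
  exact: le_trans (ler_sum_tail _ (g0 k) (leq_maxl _ _)) (gN k Q).
exact: le_trans (ler_sum_tail _ (h0 k) (leq_maxr _ _)) (hN' k Q).
Qed.

Lemma unif_tail_sum (g : nat -> nat -> nat -> R) D :
  (forall m k l, 0 <= g m k l) -> (forall m, unif_tail (g m)) ->
  unif_tail (fun k l => \sum_(0 <= m < D) g m k l).
Proof.
move=> g0 tg; elim: D => [|D IH].
  move=> eps eps0; exists 0%N => k Q.
  by rewrite big1 ?ltW// => l _; rewrite big_geq.
apply: (@unif_tail_le _
  (fun k l => \sum_(0 <= m < D) g m k l + g D k l) 1) => //.
  by move=> k l; rewrite mul1r big_nat_recr.
by apply: unif_tailD => // k l; apply: sumr_ge0.
Qed.

End uniform_tails.

Section weights.
Variables (R : realType) (w : nat -> R).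
Hypothesis w_gt0 : forall n, (0 < n)%N -> 0 < w n.
Local Notation alpha := (weight_alpha w).

Lemma weight_alpha_gt0 n : 0 < alpha n.
Proof.
rewrite invr_gt0 big_nat_cond prodr_gt0// => m; rewrite andbT => /andP[m0 _].
exact: w_gt0.
Qed.

Lemma weight_alphaS n : w n.+1 * alpha n.+1 = alpha n.
Proof.
rewrite /weight_alpha [X in _ * X^-1]big_nat_recr//= invfM mulrCA mulfV ?mulr1//.
by rewrite gt_eqF// w_gt0.
Qed.

(** The hypothesis concerns offsets i >= 1 and indices k >= 1. The offset 0 is
    reduced to the offset 1 by alpha_n <= M alpha_(n+1), and k = 0, needed to
    place the vector itself in the space, to k = 1 with the offset
    increased by u_1. *)
Lemma weight_alpha_unif_tail (p : R) (u : nat -> nat) : 1 <= p ->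
    bounded_weights w -> u 0%N = 0%N -> {homo u : m n / (m < n)%N} ->
    (forall i, (0 < i)%N -> forall eps : R, 0 < eps ->
      exists2 N, (0 < N)%N & forall k, (0 < k)%N ->
        (\sum_(N <= j <oo)
          (alpha (i + (u (j + k) - u k))%N `^ p)%:E <= eps%:E)%E) ->
  forall m, unif_tail (fun k l => alpha (m + (u (k + l) - u k))%N `^ p).
Proof.
move=> p1 [M wM] u0 u_incr alpha_unif.
have tail_gt0 i : (0 < i)%N -> forall eps : R, 0 < eps ->
    exists N, forall k Q, (0 < k)%N ->
      \sum_(N <= l < Q) alpha (i + (u (k + l) - u k))%N `^ p <= eps.
  move=> i0 eps /(alpha_unif i i0)[N _ HN]; exists N => k Q k0.
  rewrite -lee_fin -sumEFin; apply: le_trans (HN k k0).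
  under eq_bigr do rewrite (addnC k).
  by apply: nneseries_lim_ge => l _ _; rewrite lee_fin powR_ge0.
have tail i : (0 < i)%N ->
    unif_tail (fun k l => alpha (i + (u (k + l) - u k))%N `^ p).
  move=> i0 eps eps0; have [N HN] := tail_gt0 i i0 eps eps0.
  have [|N' HN'] := tail_gt0 (i + u 1%N)%N _ eps eps0.
    by rewrite addn_gt0 i0.
  exists (maxn N N'.+1) => -[|k] Q; last first.
    apply: le_trans (HN k.+1 Q isT); apply: ler_sum_tail (leq_maxl _ _) => l.
    exact: powR_ge0.
  apply: le_trans (HN' 1%N Q.-1 isT).
  apply: (@le_trans _ _ (\sum_(N'.+1 <= l < Q)
      alpha (i + (u (0 + l) - u 0))%N `^ p)).
    by apply: ler_sum_tail (leq_maxr _ _) => l; exact: powR_ge0.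
  rewrite big_add1 le_eqVlt; apply/orP; left; apply/eqP/eq_bigr => l _.
  rewrite u0 subn0 add0n add1n -addnA subnKC//.
  by case: l => // l; exact/ltnW/u_incr.
move=> [|m]; last exact: tail.
apply: (@unif_tail_le _ _
  (fun k l => alpha (1 + (u (k + l) - u k))%N `^ p) (M `^ p)).
- exact: powR_ge0.
- move=> k l; set n := (u (k + l) - u k)%N; rewrite add0n add1n.
  have a0 := ltW (weight_alpha_gt0 n.+1).
  have M0 : 0 <= M by exact: le_trans (wM 1%N isT).
  rewrite -powRM//; apply: ge0_ler_powR; rewrite ?nnegrE ?mulr_ge0//.
  + exact: le_trans p1.
  + exact/ltW/weight_alpha_gt0.
  rewrite -weight_alphaS ler_wpM2r//.
  by apply: le_trans (wM n.+1 isT); exact: ler_norm.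
- exact: tail.
Qed.

End weights.

(** Each class j only requires that finitely many uniform tails be small, so the
    gaps can be chosen class by class. *)
Lemma gap_choice (R : realType) (V : zmodType) (phi : V -> R)
    (a : nat -> R) (u : nat -> nat) (P : nat -> seq V) :
    phi 0 = 0 -> (forall n, 0 <= a n) ->
    (forall m, unif_tail (fun k l => a (m + (u (k + l) - u k))%N)) ->
  exists D E : nat -> nat,
  [/\ forall i j, (i <= j)%N -> (size (P i) <= D j)%N,
      forall i j m, (i <= j)%N -> phi (nth 0 (P i) m) <= (D j)%:R,
      forall j, (D j <= 2 ^ E j)%N &
      forall j k Q, (D j)%:R * (\sum_(E j <= l < Q)
        \sum_(0 <= m < D j) a (m + (u (k + l) - u k))%N) <= 2^-1 ^+ j].
Proof.
move=> phi0 a_ge0 tail_a.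
pose D0 i := (size (P i) +
  \sum_(0 <= m < size (P i)) (Num.truncn (phi (nth 0%R (P i) m))).+1)%N.
pose D j := (\sum_(0 <= i < j.+1) D0 i)%N.
have D0D i j : (i <= j)%N -> (D0 i <= D j)%N.
  by move=> ij; rewrite /D (big_rem i) ?mem_index_iota ?ltnS//= leq_addr.
have size_D i j : (i <= j)%N -> (size (P i) <= D j)%N.
  by move=> ij; apply: leq_trans (D0D i j ij); rewrite leq_addr.
have phi_D i j m : (i <= j)%N -> phi (nth 0 (P i) m) <= (D j)%:R.
  move=> ij; have [mi|im] := ltnP m (size (P i)); last first.
    by rewrite nth_default// phi0.
  apply: le_trans (ltW (truncnS_gt _)) _; rewrite ler_nat.
  apply: leq_trans (D0D i j ij); apply: leq_trans (leq_addl _ _).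
  by rewrite (big_rem m) ?mem_index_iota//= leq_addr.
have chooseE j : exists E, (D j <= 2 ^ E)%N /\
    forall k Q, (D j)%:R * (\sum_(E <= l < Q)
      \sum_(0 <= m < D j) a (m + (u (k + l) - u k))%N) <= 2^-1 ^+ j.
  have tailD : unif_tail (fun k l => (D j)%:R *
      \sum_(0 <= m < D j) a (m + (u (k + l) - u k))%N).
    apply: (unif_tail_le (ler0n R (D j)) (fun k l => lexx _)).
    exact: unif_tail_sum.
  have [|N HN] := tailD (2^-1 ^+ j); first by rewrite exprn_gt0.
  exists (maxn N (D j)); split=> [|k Q].
    by rewrite (leq_trans (leq_maxr N _))// ltnW// ltn_expl.
  rewrite mulr_sumr; apply: le_trans (HN k Q).
  apply: ler_sum_tail (leq_maxl _ _) => l.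
  by rewrite mulr_ge0// sumr_ge0.
have [E HE] := choice chooseE.
by exists D, E; split => // j; have [] := HE j.
Qed.

(** * The sequence space and the weighted shift *)

Section scalars.
Variables (R : realType) (F : scalar_kind).

Lemma absrN (z : scalars R F) : absr (- z) = absr z.
Proof.
by apply: (@scalar_of_real_inj R F); rewrite !scalar_of_real_absr normrN.
Qed.

Lemma rat_approx (t eps : R) : 0 < eps -> exists q : rat, `|ratr q - t| < eps.
Proof.
move=> e0; have /rat_in_itvoo[q] : t - eps < t + eps.
  by rewrite ltrD2l gtrN.
by rewrite in_itv/= => qt; exists q; rewrite ltr_distl.
Qed.

Lemma sqrt_sum_sqr_le (x y : R) : Num.sqrt (x ^+ 2 + y ^+ 2) <= `|x| + `|y|.
Proof.
rewrite -[leRHS]ger0_norm ?addr_ge0// -[leRHS]sqrtr_sqr ler_sqrt ?sqr_ge0//.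
rewrite sqrrD !real_normK ?num_real// addrAC lerDl.
by rewrite mulrn_wge0// mulr_ge0.
Qed.

Lemma scalars_separable : exists d : nat -> scalars R F,
  forall (z : scalars R F) eps, 0 < eps -> exists n, absr (d n - z) < eps.
Proof.
rewrite /absr /scalars; case: F.
- exists (fun n => ratr (odflt 0 (unpickle n))) => z e e0.
  by have [q qz] := rat_approx z e0; exists (pickle q); rewrite pickleK.
- exists (fun n => let q : rat * rat := odflt (0, 0) (unpickle n) in
    (ratr q.1 +i* ratr q.2)%C) => -[a b] e e0.
  have e2 : 0 < e / 2 by rewrite divr_gt0.
  have [q qa] := rat_approx a e2; have [r rb] := rat_approx b e2.
  exists (pickle (q, r)); rewrite pickleK/=.
  set x := ratr q - a in qa *; set y := ratr r - b in rb *.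
  apply: (@le_lt_trans _ _ (`|x| + `|y|)); last by rewrite [ltRHS]splitr ltrD.
  exact: sqrt_sum_sqr_le.
Qed.

End scalars.

Section lp.
Variables (R : realType) (F : scalar_kind) (p : R).
Hypothesis p1 : 1 <= p.
Local Notation K := (scalars R F).

Let p_gt0 : 0 < p. Proof. exact: lt_le_trans p1. Qed.

Lemma lp_norm_le_sum (v : nat -> K^o) C :
  (forall Q, \sum_(0 <= n < Q) absr (v n) `^ p <= C) ->
  (lp_norm p v <= (C `^ p^-1)%:E)%E.
Proof.
move=> vC; have C0 : 0 <= C by apply: le_trans (vC 0%N); rewrite big_geq.
rewrite lp_normE// -poweR_EFin; apply: gt0_ler_poweR.
- by rewrite invr_ge0 ltW.
- rewrite in_itv/= leey andbT; apply: nneseries_ge0 => n _ _.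
  by rewrite lee_fin powR_ge0.
- by rewrite in_itv/= leey andbT lee_fin.
- apply: lime_le.
    by apply: is_cvg_nneseries => n _ _; rewrite lee_fin powR_ge0.
  by apply: nearW => Q; rewrite sumEFin lee_fin.
Qed.

Lemma lp_tail_small (v : nat -> K^o) (eps : R) : 0 < eps ->
    (lp_norm p v < +oo)%E ->
  exists L, forall Q, \sum_(L <= n < Q) absr (v n) `^ p <= eps.
Proof.
move=> e0; rewrite lp_normE// => vfin.
have v0 n : (0 <= (absr (v n) `^ p)%:E)%E by rewrite lee_fin powR_ge0.
have sum_fin : (\sum_(n <oo) (absr (v n) `^ p)%:E < +oo)%E.
  move: vfin; apply: contraTlt; rewrite leye_eq => /eqP ->.
  by rewrite poweRyr ?invr_neq0 ?gt_eqF.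
have /fine_cvgP[finL] := nneseries_tail_cvg sum_fin (fun n _ => v0 n).
move=> /cvgr0Pnorm_lt/(_ _ e0) smallL.
have [L _ HL] : \forall L \near \oo,
    (\sum_(L <= n <oo) (absr (v n) `^ p)%:E <= eps%:E)%E.
  near=> L; rewrite -[leLHS]fineK; last by near: L.
  rewrite lee_fin; apply: le_trans (ler_norm _) _; apply: ltW; near: L.
  exact: smallL.
exists L => Q; rewrite -lee_fin -sumEFin; apply: le_trans (HL L (leqnn L)).
by apply: nneseries_lim_ge => n _ _; exact: v0.
Unshelve. all: by end_near. Qed.

(** The entries beyond a cut L are dropped by convergence of the series, the
    others are approximated one by one, each within eps / (2(L+1)). *)
Lemma lp_approx_finite (d : nat -> K) (v : nat -> K^o) (eps : R) :
    (forall z e, 0 < e -> exists n, absr (d n - z) < e) ->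
    0 < eps -> (lp_norm p v < +oo)%E ->
  exists s : seq nat, forall Q,
    \sum_(0 <= n < Q) absr (v n - nth 0 (map d s) n) `^ p <= eps.
Proof.
move=> d_dense e0 vfin; have e2 : 0 < eps / 2 by rewrite divr_gt0.
have [L vL] := lp_tail_small e2 vfin.
pose dl := eps / 2 / L.+1%:R.
have dl0 : 0 < dl by rewrite divr_gt0.
have /choice[f fv] : forall n, exists m, absr (d m - v n) < dl `^ p^-1.
  by move=> n; apply: d_dense; exact: powR_gt0.
exists (mkseq f L) => Q.
apply: (@le_trans _ _ (\sum_(0 <= n < L + Q)
    absr (v n - nth 0 (map d (mkseq f L)) n) `^ p)).
  rewrite (big_cat_nat (leq0n Q) (leq_addl L Q))/= lerDl sumr_ge0// => n _.
  exact: powR_ge0.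
rewrite (big_cat_nat (leq0n L) (leq_addr Q L))/= [leRHS]splitr lerD//.
- apply: (@le_trans _ _ (\sum_(0 <= n < L) dl)).
    apply: ler_sum_nat => n /andP[_ nL].
    rewrite (nth_map 0%N) ?size_mkseq// nth_mkseq// -absrN opprB.
    rewrite -[leRHS]powRr1 ?(ltW dl0)// -(mulVf (lt0r_neq0 p_gt0)) powRrM.
    by rewrite ge0_ler_powR ?nnegrE ?absr_ge0 ?powR_ge0 ?(ltW p_gt0)// ltW.
  rewrite sumr_const_nat subn0 -[dl *+ L]mulr_natr /dl -mulrA.
  rewrite ler_piMr ?(ltW e2)//.
  by rewrite mulrC ler_pdivrMr// mul1r ler_nat.
- apply: le_trans (vL (L + Q)%N); rewrite le_eqVlt; apply/orP; left.
  apply/eqP/eq_big_nat => n /andP[Ln _].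
  by rewrite nth_default ?subr0// size_map size_mkseq.
Qed.

(** The norm takes its values in the scalar field; the radius has to be brought
    back to a real number. *)
Lemma lp_open_ball (U : set (lp F p1)) v : open U -> U v ->
  exists2 r : R, 0 < r & forall x : lp F p1,
    (lp_norm p (fun n => v n - x n)%R < r%:E)%E -> U x.
Proof.
move=> oU Uv; have : nbhs v U by apply: open_nbhs_nbhs.
move=> /nbhs_ballP[e /= e0 eU].
have eE : scalar_of_real F (absr e) = e by rewrite scalar_of_real_absr gtr0_norm.
exists (absr e).
  rewrite lt_neqAle absr_ge0 andbT eq_sym; apply/eqP => /absr0_eq0 eE0.
  by rewrite eE0 ltxx in e0.
move=> x vx; apply: eU; rewrite -ball_normE /ball_/= lp_normedE -eE lt_neqAle.
rewrite scalar_of_real_le (inj_eq (@scalar_of_real_inj R F)) -lt_neqAle.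
by rewrite -lte_fin lp_normrE.
Qed.

End lp.

Section shift.
Variables (R : realType) (F : scalar_kind) (p : R) (p1 : 1 <= p).
Variables (w : nat -> R) (w_bounded : bounded_weights w).
Local Notation K := (scalars R F).

Lemma wshift_continuous : continuous (wshift F p1 w_bounded).
Proof.
have [M wM] := w_bounded; have M0 : 0 <= M by apply: le_trans (wM 1%N isT).
apply: bounded_linear_continuous; apply/linear_boundedP.
near=> r => x; apply: (@le_trans _ _ (scalar_of_real F M * `|x|)).
  rewrite !lp_normedE -scalar_of_realM scalar_of_real_le -lee_fin EFinM !lp_normrE.
  exact: lp_norm_wshift_fun.
rewrite ler_wpM2r//; near: r; apply: nbhs_pinfty_ge.
by rewrite -(ger0_norm M0) -(absr_real F) scalar_of_real_absr normr_real.
Unshelve. all: by end_near. Qed.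

Hypothesis w_gt0 : forall n, (0 < n)%N -> 0 < w n.
Local Notation alpha := (weight_alpha w).

(** Dividing the coordinates by alpha turns the weighted shift into the
    unweighted one. *)
Lemma iter_wshift (z : nat -> K) s (x : lp F p1) :
    (forall n, x n = scalar_of_real F (alpha n) * z n) ->
  forall n, iter s (wshift F p1 w_bounded) x n =
    scalar_of_real F (alpha n) * z (n + s)%N.
Proof.
move=> xz; elim: s => [|s IH] n; first by rewrite addn0.
rewrite iterS /= /wshift_fun IH addSnnS mulrA -scalar_of_realM.
by rewrite weight_alphaS.
Qed.

End shift.

(** * Construction of the vector *)

Lemma half_expr_small (R : realType) (C : R) : 0 < C ->
  exists b, 2 * 2^-1 ^+ b <= C.
Proof.
move=> C0; exists (Num.truncn (2 / C)).+1; set b := _.+1.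
rewrite exprVn ler_pdivrMr ?exprn_gt0// mulrC -ler_pdivrMr//.
apply: le_trans (ltW (truncnS_gt _)) _.
by rewrite -natrX ler_nat ltnW// ltn_expl.
Qed.

Theorem theorem4p1 (R : realType) (F : scalar_kind)
    (rho : R -> R) (rho_calib : calibration_function rho)
    (p : R) (p1 : 1 <= p)
    (w : nat -> R) (w_gt0 : forall n, (0 < n)%N -> 0 < w n)
    (w_bounded : bounded_weights w)
    (alpha_unif : forall i : nat, (0 < i)%N -> forall eps : R, 0 < eps ->
      exists2 N : nat, (0 < N)%N & forall k : nat, (0 < k)%N ->
        (\sum_(N <= j <oo)
           (weight_alpha w (i + (calib_u rho (j + k) - calib_u rho k))%N
              `^ p)%:E <= eps%:E)%E) :
  frequently_hypercyclic rho (wshift F p1 w_bounded).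
Proof.
split; first exact: wshift_continuous.
have p0 : 0 < p by exact: lt_le_trans p1.
set u := calib_u rho in alpha_unif *.
have u0 : u 0%N = 0%N := calib_u0 rho_calib.
have u_incr : {homo u : m n / (m < n)%N} := calib_u_incr rho_calib.
pose alpha := weight_alpha w.
have alpha_gt0 n : 0 < alpha n := weight_alpha_gt0 w_gt0 n.
pose sr : R -> scalars R F := scalar_of_real F.
have sr_alpha n : sr (alpha n) != 0.
  apply/eqP; rewrite -(scalar_of_real0 R F) => /scalar_of_real_inj a0.
  by have := alpha_gt0 n; rewrite a0 ltxx.
pose phi (c : scalars R F) : R := absr c `^ p.
have phi0 : phi 0 = 0 by rewrite /phi absr0 powR0// gt_eqF.
have phi_alpha n c : absr (sr (alpha n) * c) `^ p = alpha n `^ p * phi c.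
  by rewrite absrM absr_real ger0_norm ?(ltW (alpha_gt0 n))// powRM ?absr_ge0// ltW.
have [d d_dense] := scalars_separable R F.
(* Since logn 2 takes each value at arbitrarily large i.+1, each finite sequence
   is the target of infinitely many classes, which allows errors depending on
   the class. *)
pose y i : seq (scalars R F) := map d (odflt [::] (unpickle (logn 2 i.+1))).
pose P i := mkseq (fun m => nth 0 (y i) m / sr (alpha m)) (size (y i)).
have PE i m : sr (alpha m) * nth 0 (P i) m = nth 0 (y i) m.
  have [mi|im] := ltnP m (size (y i)).
    by rewrite nth_mkseq// mulrC divfK.
  by rewrite !nth_default ?mulr0// size_mkseq.
have [D [E [size_D phi_D D_E tail_E]]] := @gap_choice _ _ phi _ u P
  phi0 (fun n => powR_ge0 (alpha n) p)
  (weight_alpha_unif_tail w_gt0 p1 w_bounded u0 u_incr alpha_unif).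
pose z := splice u P E.
have x_lp : (fun n => sr (alpha n) * z n) \in @lp_pred R F p.
  rewrite inE/=; apply: le_lt_trans (ltry (2 `^ p^-1)).
  apply: lp_norm_le_sum => // Q; under eq_bigr do rewrite phi_alpha.
  exact: (splice_bounded phi0 (fun n => powR_ge0 _ _) u_incr size_D phi_D tail_E).
pose x : lp F p1 := Lp p1 x_lp.
have x_return k i : block_start E k -> block_class k = i ->
    (lp_norm p
      (fun n => (nth 0 (y i) n - iter (u k) (wshift F p1 w_bounded) x n)%R)
      <= ((2 * 2^-1 ^+ i) `^ p^-1)%:E)%E.
  move=> sk ki; apply: lp_norm_le_sum => // Q.
  under eq_bigr => n _.
    rewrite (@iter_wshift _ _ _ _ _ w_bounded w_gt0 z (u k) x)//.
    rewrite -absrN opprB -PE -mulrBr phi_alpha.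
    over.
  exact: (splice_return phi0 (fun n => powR_ge0 _ _) u_incr size_D phi_D D_E tail_E).
exists x => U oU [v Uv].
have [r r0 vU] := lp_open_ball oU Uv.
have r3 : 0 < r / 3 by rewrite divr_gt0.
pose C := (r / 3) `^ p; have C0 : 0 < C by exact: powR_gt0.
have CE : C `^ p^-1 = r / 3 by rewrite -powRrM mulfV ?gt_eqF// powRr1// ltW.
have vfin : (lp_norm p v < +oo)%E by have := lp_valP v; rewrite inE.
have [s vs] := lp_approx_finite p1 d_dense C0 vfin.
have [b bC] := half_expr_small C0.
(* A class with target s and index at least b. *)
pose i := (2 ^ pickle s * b.*2.+1).-1.
have iE : i.+1 = (2 ^ pickle s * b.*2.+1)%N by rewrite prednK// muln_gt0 expn_gt0.
have bi : (b <= i)%N.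
  rewrite -ltnS iE (leq_trans _ (leq_pmull _ _)) ?expn_gt0//.
  by rewrite ltnS -addnn leq_addr.
have yi : y i = map d s by rewrite /y iE logn2_odd pickleK.
have iC : 2 * 2^-1 ^+ i <= C.
  by apply: le_trans bC; rewrite ler_wpM2l// ler_wiXn2l// invf_le1// ler1n.
apply: (@blocks_lower_density _ _ E _ i) => // k sk ki /=; apply: vU.
apply: (@le_lt_trans _ _ ((r / 3 + r / 3)%:E)); last first.
  by rewrite lte_fin; lra.
have -> : (fun n => v n - iter (calib_u rho k) (wshift F p1 w_bounded) x n) =
    (fun n => v n - nth 0 (y i) n) +
    (fun n => nth 0 (y i) n - iter (u k) (wshift F p1 w_bounded) x n).
  by apply/funext => n /=; rewrite addrA subrK.
apply: le_trans (lp_normD p1 _ _) _; rewrite EFinD; apply: leeD.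
  by rewrite -CE yi; exact: lp_norm_le_sum.
apply: le_trans (x_return k i sk ki) _.
rewrite lee_fin -CE ge0_ler_powR ?nnegrE ?invr_ge0 ?(ltW p0) ?(ltW C0)//.
Qed.
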